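(* There is a Borel reduction from $E_0$ to $\cong_{\mathrm{Ar}(\mathbb{Q}^2)}$. In particular, $\cong_{\mathrm{Ar}(\mathbb{Q}^2)}$ is not concretely classifiable, i.e.\ it is not Borel reducible to the equality relation $=_{\mathbb{R}}$ on $\mathbb{R}$.
   Context: An order $<$ on the additive group $\mathbb{Q}^2$ is identified with its positive cone $P=\{x\in\mathbb{Q}^2: 0<x\}$; positive cones are exactly the sets $P\subseteq\mathbb{Q}^2$ with $P+P\subseteq P$ and $\mathbb{Q}^2=P\sqcup(-P)\sqcup\{0\}$. Such an order is Archimedean if for all $x,y\in\mathbb{Q}^2$ there is $k\in\mathbb{Z}$ with $ky-x\in P$. $\mathrm{Ar}(\mathbb{Q}^2)$ is the set of positive cones of Archimedean orders on $\mathbb{Q}^2$, a $G_\delta$ subset of $2^{\mathbb{Q}^2}$ (product topology), hence a Polish space. $\cong_{\mathrm{Ar}(\mathbb{Q}^2)}$ is the equivalence relation on $\mathrm{Ar}(\mathbb{Q}^2)$ given by $P\cong S$ iff there is $\psi\in\mathrm{GL}_2(\mathbb{Q})$ with $\psi(P)=S$ (i.e.\ the ordered groups are order isomorphic). $E_0$ is the equivalence relation on $2^{\mathbb{N}}$ of eventual equality. For equivalence relations $E,F$ on standard Borel spaces $X,Y$, a Borel reduction is a Borel map $f:X\to Y$ with $x\mathrel{E}y\iff f(x)\mathrel{F}f(y)$; $E\le_B F$ means one exists.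
   Formalization: The Archimedean condition is required only for nonzero y: as displayed, for all x and y, it fails at x = y = 0 since 0 is not in P, so Ar(Q^2) would be empty and no reduction from E_0 could exist. *)

(* Defs.v *)
From HB Require Import structures.
From mathcomp Require Import all_boot all_order all_algebra.
From mathcomp Require Import all_classical all_reals all_analysis.

Set Implicit Arguments.
Unset Strict Implicit.
Unset Printing Implicit Defensive.

Import Order.TTheory GRing.Theory Num.Theory.
Import numFieldNormedType.Exports.

Local Open Scope classical_set_scope.
Local Open Scope ring_scope.

(* [<<s open >>] is used directly, rather than [measurable_fun], because
   [measurableType] requires a distinguished point. *)
Definition borel_map (X Y : topologicalType) (f : X -> Y) : Prop :=
  forall B : set Y, <<s @open Y >> B -> <<s @open X >> (f @^-1` B).

Definition borel_reduction (X Y : topologicalType)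
    (E : X -> X -> Prop) (F : Y -> Y -> Prop) (f : X -> Y) : Prop :=
  borel_map f /\ forall x y : X, E x y <-> F (f x) (f y).

Definition borel_reducible (X Y : topologicalType)
    (E : X -> X -> Prop) (F : Y -> Y -> Prop) : Prop :=
  exists f : X -> Y, borel_reduction E F f.

Definition concretely_classifiable (R : realType) (X : topologicalType)
    (E : X -> X -> Prop) : Prop :=
  borel_reducible E (fun r s : R => r = s).

Definition E0 (x y : cantor_space) : Prop := \forall n \near \oo, x n = y n.

Definition positive_cone (V : zmodType) (P : set V) : Prop :=
  [/\ forall x y, P x -> P y -> P (x + y),
      P `|` -%R @` P `|` [set 0] = setT,
      P `&` -%R @` P = set0,
      P `&` [set 0] = set0
    & -%R @` P `&` [set 0] = set0].

(* The case y = 0 has to be excluded: no multiple of 0 exceeds a positive x. *)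
Definition archimedean_cone (V : zmodType) (P : set V) : Prop :=
  forall x y : V, y != 0 -> exists k : int, P (y *~ k - x).

Notation Q2 := 'cV[rat]_2.

Definition ArQ2_set : set {ptws Q2 -> bool} :=
  [set P | positive_cone [set x | P x] /\ archimedean_cone [set x | P x]].

(* [initial_topology] of the inclusion is the subspace topology. *)
Definition ArQ2 : topologicalType :=
  initial_topology (fun P : ArQ2_set => set_val P).

Definition cone_of (P : ArQ2) : set Q2 := [set x | set_val P x].

Definition ArQ2_iso (P S : ArQ2) : Prop :=
  exists2 psi : 'M[rat]_2,
    psi \in unitmx & (fun x => psi *m x) @` cone_of P = cone_of S.

(* Main.v *)
(* An irrational [s] gives the Archimedean cone [v0 + s v1 > 0], and two such
   cones are isomorphic only if their slopes [s], [s'] satisfy a nontrivial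
   relation [c s s' + d s' + e s + f = 0] with rational coefficients. A bit
   sequence is sent to a slope [sum_n a_n / 2 ^ 3 ^ (n + 1)], with digits 1 and
   2 coding the bits. The expansion is so sparse that such a relation passes to
   the partial sums, which forces [c = 0] and [d a'_n + e a_n = 0] for large
   [n]: isomorphic cones have eventually equal digits. Conversely, eventually
   equal digits give slopes with a rational difference, hence cones related by
   a shear.

   E0 is not smooth: by the zero-one law for Baire category, a Borel
   E0-invariant real function is constant on a comeager set, and this set
   contains some sequence together with its bitwise complement. *)
Require Import Defs.
From mathcomp Require Import all_boot all_order all_algebra.
From mathcomp Require Import all_classical all_reals all_analysis.
From mathcomp Require Import ring lra zify.

Set Implicit Arguments.
Unset Strict Implicit.
Unset Printing Implicit Defensive.

Import Order.TTheory GRing.Theory Num.Theory.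
Import numFieldNormedType.Exports.

Local Open Scope classical_set_scope.
Local Open Scope ring_scope.

(** * Continuity, Borel maps and cylinders *)

Lemma cvg_prod_topology (I : Type) (K : I -> topologicalType)
    (F : set_system (prod_topology K)) (f : prod_topology K) :
  Filter F -> (forall i, (fun g : prod_topology K => g i) @ F --> f i) ->
  F --> f.
Proof.
move=> FF cvgF; apply/cvg_sup => i A /= [_ [[B Bop <-] Bfi sBA]].
by apply: filterS sBA _; apply: cvgF; exact: open_nbhs_nbhs.
Qed.

Lemma borel_map_continuous (X Y : topologicalType) (f : X -> Y) :
  continuous f -> borel_map f.
Proof.
move=> cf; rewrite /borel_map; apply: smallest_sub => [|B oB].
  have [h0 hC hU] := smallest_sigma_algebra setT (@open X).
  split=> [|A mA|A mA]; first exact: h0.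
    by rewrite setTD preimage_setC -setTD; exact: hC.
  by rewrite preimage_bigcup; exact: hU.
by apply: sub_sigma_algebra; move/continuousP: cf; exact.
Qed.

Lemma borel_map_comp (X Y Z : topologicalType) (g : Y -> Z) (f : X -> Y) :
  borel_map g -> borel_map f -> borel_map (g \o f).
Proof. by move=> bg bf B /bg /bf. Qed.

Definition cylinder (k : nat) (z : cantor_space) : set cantor_space :=
  [set y | forall i, (i < k)%N -> y i = z i].

Lemma cylinder_nbhs k z : nbhs z (cylinder k z).
Proof.
elim: k => [|k IHk]; first by apply: filterS filterT.
have zk : nbhs z [set y : cantor_space | y k = z k].
  apply: (@proj_continuous _ (fun=> bool) k z [set z k]).
  by rewrite nbhs_principalE.
apply: filterS (filterI IHk zk) => y [yz yk] i.
by rewrite ltnS leq_eqVlt => /orP[/eqP->|/yz].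
Qed.

Lemma nbhs_cylinder (z : cantor_space) (U : set cantor_space) :
  nbhs z U -> exists k, cylinder k z `<=` U.
Proof.
move=> zU.
(* The cylinders at [z] generate a filter, whose convergence to [z] is checked coordinate by
   coordinate. *)
suff : filter_from setT (fun k => cylinder k z) --> z.
  by move=> /(_ _ zU)[k _ kU]; exists k.
apply: cvg_prod_topology.
  apply: filter_from_filter; first by exists 0%N.
  move=> i j _ _; exists (maxn i j) => // y yz.
  by split=> l ll; apply: yz; rewrite leq_max ll ?orbT.
move=> i A zA; exists i.+1 => // y yz.
by rewrite /= yz //; exact: nbhs_singleton.
Qed.

Lemma cylinder_le k k' z : (k <= k')%N -> cylinder k' z `<=` cylinder k z.
Proof. by move=> kk' y yz i ik; apply: yz; exact: leq_trans kk'. Qed.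

Lemma cylinder_trans k x y z :
  cylinder k x y -> cylinder k y z -> cylinder k x z.
Proof. by move=> xy yz i ik; rewrite yz // xy. Qed.

(** Padding with [false] gives finite support: [xor_by (word s)] alters finitely many bits, and the
    countable type [seq bool] names all cylinders. *)
Definition word (s : seq bool) : cantor_space := nth false s.

Lemma cylinder_word k z : cylinder k (word (mkseq z k)) = cylinder k z.
Proof.
by apply/seteqP; split=> y yz i ik; rewrite yz // /word nth_mkseq.
Qed.

Definition xor_by (z x : cantor_space) : cantor_space := fun i => x i (+) z i.

Lemma xor_byK z : involutive (xor_by z).
Proof. by move=> x; apply/funext => i; rewrite /xor_by addbK. Qed.

Lemma cylinder_xor k w z y :
  cylinder k (xor_by w z) (xor_by w y) <-> cylinder k z y.
Proof.
split=> yz i ik; first exact/addIb/yz.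
by rewrite /xor_by yz.
Qed.

(** * Baire category on the Cantor space *)

Definition nowhere_dense (F : set cantor_space) : Prop :=
  forall z k, exists z' k', cylinder k z z' /\ cylinder k' z' `<=` ~` F.

Definition meager (M : set cantor_space) : Prop :=
  exists2 F : nat -> set cantor_space,
    (forall n, nowhere_dense (F n)) & M `<=` \bigcup_n F n.

Lemma nowhere_dense_meager F : nowhere_dense F -> meager F.
Proof. by move=> ndF; exists (fun=> F) => // x Fx; exists 0%N. Qed.

Lemma nowhere_dense0 : nowhere_dense set0.
Proof. by move=> z k; exists z, k; split=> // y _ []. Qed.

Lemma meager0 : meager set0.
Proof. exact: nowhere_dense_meager nowhere_dense0. Qed.

Lemma meagerS M N : M `<=` N -> meager N -> meager M.
Proof. by move=> MN [F ndF NF]; exists F => //; exact: subset_trans NF. Qed.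

Lemma meager_bigcup (I : countType) (M : I -> set cantor_space) :
  (forall i, meager (M i)) -> meager (\bigcup_i M i).
Proof.
move=> mM; have /choice[F FP] : forall i, exists F : nat -> set cantor_space,
    (forall n, nowhere_dense (F n)) /\ M i `<=` \bigcup_n F n.
  by move=> i; have [F ? ?] := mM i; exists F.
(* Pairs [(i, j)] are enumerated by their codes; a number that codes none gets the empty set. *)
exists (fun n => if unpickle n is Some (i, j) then F i j else set0).
  move=> n; case: unpickle => [[i j]|]; first exact: (FP i).1.
  exact: nowhere_dense0.
move=> x [i _ /(FP i).2[j _ Fx]]; exists (pickle (i, j)) => //.
by rewrite pickleK.
Qed.

Lemma meagerU M N : meager M -> meager N -> meager (M `|` N).
Proof.
move=> mM mN.
apply: meagerS (@meager_bigcup bool (fun b => if b then M else N) _).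
  by move=> x [Mx|Nx]; [exists true|exists false].
by case.
Qed.

Lemma meager_xor w M : meager M -> meager (xor_by w @^-1` M).
Proof.
move=> [F ndF MF]; exists (fun n => xor_by w @^-1` F n); last first.
  by move=> x /MF[n _ Fx]; exists n.
move=> n z k; have [z' [k' [zz' z'F]]] := ndF n (xor_by w z) k.
exists (xor_by w z'), k'; split; first by rewrite -(cylinder_xor k w) xor_byK.
by move=> y /(cylinder_xor k' w); rewrite xor_byK => /z'F.
Qed.

Lemma baire_cantor : ~ meager setT.
Proof.
move=> [F ndF cover].
pose T := (cantor_space * nat)%type.
have /choice[g gP] : forall p : nat * T, exists q : T,
    [/\ cylinder p.2.2 p.2.1 q.1, (p.2.2 < q.2)%N
      & cylinder q.2 q.1 `<=` ~` F p.1].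
  move=> [n [z k]]; have [z' [k' [zz' z'F]]] := ndF n z k.
  exists (z', maxn k.+1 k'); split => //=; first by rewrite leq_max leqnn.
  by apply: subset_trans z'F; apply: cylinder_le; rewrite leq_maxr.
(* Centres and lengths of nested cylinders; stage [n.+1] avoids [F n]. *)
pose p := fix p n : T := if n is m.+1 then g (m, p m) else (fun=> false, 0%N).
have p_gt n : (n <= (p n).2)%N.
  elim: n => // n IHn; have [_ lt_p _] := gP (n, p n).
  exact: leq_ltn_trans lt_p.
have p_le m n : (m <= n)%N ->
    cylinder (p m).2 (p m).1 (p n).1 /\ ((p m).2 <= (p n).2)%N.
  elim: n => [|n IHn]; first by rewrite leqn0 => /eqP->.
  rewrite leq_eqVlt => /orP[/eqP->//|/IHn[cyl le_p]].
  have [cyl' lt_p _] := gP (n, p n).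
  split; last exact: leq_trans le_p (ltnW lt_p).
  exact: cylinder_trans cyl (cylinder_le le_p cyl').
(* Bit [i] is read at stage [i.+1], where the length exceeds [i] and the bit is final. *)
pose x : cantor_space := fun i => (p i.+1).1 i.
have px n : cylinder (p n).2 (p n).1 x.
  move=> i ik; have [le_ni|lt_in] := leqP n i.+1.
    by have [cyl _] := p_le _ _ le_ni; exact: cyl.
  have [cyl _] := p_le _ _ (ltnW lt_in).
  by rewrite cyl //; exact: p_gt.
have [n _ Fx] := cover x I.
by have [_ _ /(_ x (px n.+1))] := gP (n, p n).
Qed.

(* The open set where [A] is locally meager is a countable union of cylinders,
   and its complement in [cylinder k z] is nowhere dense. *)
Lemma meager_local (A : set cantor_space) z k :
  (forall z' k', cylinder k z z' -> exists z'' k'',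
     cylinder k' z' z'' /\ meager (cylinder k'' z'' `&` A)) ->
  meager (cylinder k z `&` A).
Proof.
move=> locA.
pose C (s : seq bool) := cylinder (size s) (word s).
(* Every [M s] is meager, being empty unless [A] is meager in [C s]. *)
pose M s := [set y | meager (C s `&` A) /\ (C s `&` A) y].
have mM s : meager (M s).
  have [mC|nmC] := pselect (meager (C s `&` A)).
    by apply: meagerS mC => y [].
  by apply: meagerS meager0 => y [].
pose B := [set y | cylinder k z y /\ forall s, meager (C s `&` A) -> ~ C s y].
apply: (@meagerS _ (B `|` \bigcup_s M s)) => [y [zy Ay]|].
  have [[s [mC Cy]]|noC] := pselect (exists s, meager (C s `&` A) /\ C s y).
    by right; exists s.
  by left; split => // s mC Cy; apply: noC; exists s.
apply: meagerU (meager_bigcup mM); apply: nowhere_dense_meager => z' k'.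
have [zz'|nzz'] := pselect (cylinder k z z'); last first.
  exists z', k; split => // y z'y [zy _]; apply: nzz' => i ik.
  by rewrite -zy // z'y.
have [z'' [k'' [z'z'' mA]]] := locA z' k' zz'.
exists z'', k''; split => // y z''y [_ /(_ (mkseq z'' k''))].
by rewrite /C size_mkseq cylinder_word; exact.
Qed.

(* Equivalent to the Baire property, in a form that is visibly a
   sigma-algebra. *)
Definition decided (A : set cantor_space) : Prop :=
  forall z k, exists z' k', cylinder k z z' /\
    (meager (cylinder k' z' `&` A) \/ meager (cylinder k' z' `&` ~` A)).

Lemma decided_open A : open A -> decided A.
Proof.
move=> oA z k; have [[z' [zz' Az']]|noA] :=
  pselect (exists z', cylinder k z z' /\ A z').
  have [k' z'A] := nbhs_cylinder (open_nbhs_nbhs (conj oA Az')).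
  exists z', k'; split => //; right; apply: meagerS meager0 => y [/z'A].
  by [].
exists z, k; split => //; left; apply: meagerS meager0 => y [zy Ay].
by apply: noA; exists y.
Qed.

Lemma decidedC A : decided A -> decided (~` A).
Proof.
move=> dA z k; have [z' [k' [zz' mA]]] := dA z k.
by exists z', k'; split => //; rewrite setCK; case: mA; [right|left].
Qed.

(** If no [A n] is comeager in a cylinder centred in [cylinder k z], decidedness makes every [A n]
    locally meager there, and [meager_local] applies to each. *)
Lemma decided_bigcup (A : nat -> set cantor_space) :
  (forall n, decided (A n)) -> decided (\bigcup_n A n).
Proof.
move=> dA z k.
have [[n [z' [k' [zz' mA]]]]|nA] := pselect (exists n z' k',
    cylinder k z z' /\ meager (cylinder k' z' `&` ~` A n)).
  exists z', k'; split => //; right; apply: meagerS mA => y [z'y nAy].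
  by split => // Ay; apply: nAy; exists n.
exists z, k; split => //; left; rewrite setI_bigcupr.
apply: meager_bigcup => n; apply: meager_local => z' k' zz'.
have [z'' [k'' [z'z'' [mA|mA]]]] := dA n z' (maxn k k').
  exists z'', k''; split => //.
  by apply: cylinder_le z'z''; rewrite leq_maxr.
case: nA; exists n, z'', k''; split => //; apply: cylinder_trans zz' _.
by apply: cylinder_le z'z''; rewrite leq_maxl.
Qed.

Lemma decided_borel A : <<s @open cantor_space >> A -> decided A.
Proof.
move: A; apply: smallest_sub => [|A]; last exact: decided_open.
split=> [|A dA|A dA]; first by apply: decided_open; exact: open0.
  by rewrite setTD; exact: decidedC.
exact: decided_bigcup.
Qed.

(** * The zero-one law for [E0]-invariant sets *)

Lemma E0P x y : E0 x y <-> exists N, forall n, (N <= n)%N -> x n = y n.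
Proof. by split=> [[N _ xy]|[N xy]]; exists N. Qed.

Lemma E0_sym x y : E0 x y -> E0 y x.
Proof. by move=> /E0P[N xy]; apply/E0P; exists N => n /xy. Qed.

Lemma E0_xor_word s x : E0 x (xor_by (word s) x).
Proof.
apply/E0P; exists (size s) => n sn.
by rewrite /xor_by /word nth_default // addbF.
Qed.

(** Countably many finitely supported translates of [cylinder k z] cover the space, and by
    invariance each meets [B] in a translate of the given meager set. *)
Lemma meager_E0_invariant (B : set cantor_space) z k :
  (forall x y, E0 x y -> B x -> B y) -> meager (cylinder k z `&` B) -> meager B.
Proof.
move=> invB mB.
apply: meagerS (meager_bigcup (fun s : seq bool => meager_xor (word s) mB)).
move=> y By; exists (mkseq (fun i => y i (+) z i) k) => //; split.
  by move=> i ik; rewrite /xor_by /word nth_mkseq // addbA addbb.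
exact: invB (E0_xor_word _ _) By.
Qed.

Lemma E0_zero_one A : <<s @open cantor_space >> A ->
  (forall x y, E0 x y -> A x -> A y) -> meager A \/ meager (~` A).
Proof.
move=> /decided_borel dA invA.
have [z [k [_ [mA|mA]]]] := dA (fun=> false) 0%N.
  by left; exact: meager_E0_invariant mA.
right; apply: meager_E0_invariant mA => x y xy nAx Ay.
by apply: nAx; apply: invA Ay; exact: E0_sym.
Qed.

(* A Borel [f] constant on E0-classes is constant on a comeager set, which
   meets its image under complementation of all the bits. *)
Lemma E0_not_concretely_classifiable (R : realType) :
  ~ concretely_classifiable R E0.
Proof.
move=> [f [bf fP]].
pose A (q : rat) := [set x | f x < ratr q].
have mA q : meager (A q) \/ meager (~` A q).
  apply: E0_zero_one => [|x y /fP + fx]; last by rewrite /A /= => <-.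
  have -> : A q = f @^-1` `]-oo, (ratr q)[.
    by apply/seteqP; split=> x; rewrite /A /= in_itv.
  by apply: bf; apply: sub_sigma_algebra; exact: interval_open.
(* For each [q], whichever of [A q] and its complement is meager goes into [M]; points off [M] thus
   have images with the same rational cut. *)
pose M := \bigcup_q [set x | (A q x /\ meager (A q)) \/
                             (~ A q x /\ meager (~` A q))].
have mM : meager M.
  apply: meager_bigcup => q.
  have hS (B : set cantor_space) : meager [set x | B x /\ meager B].
    have [mB|nB] := pselect (meager B); first by apply: meagerS mB => x [].
    by apply: meagerS meager0 => x [].
  by apply: meagerS (meagerU (hS (A q)) (hS (~` A q))) => x.
pose neg := xor_by (fun=> true).
have [x [Mx Mnx]] : exists x, ~ M x /\ ~ M (neg x).
  apply: contrapT => noX; apply: baire_cantor.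
  apply: meagerS (meagerU mM (meager_xor (fun=> true) mM)) => x _.
  have [Mx|Mx] := pselect (M x); first by left.
  by right; apply: contrapT => Mnx; apply: noX; exists x.
have Aiff q : A q x <-> A q (neg x).
  have [mAq|mAq] := mA q; split=> Aq.
  - by case: Mx; exists q => //; left.
  - by case: Mnx; exists q => //; left.
  - by apply: contrapT => nA; case: Mnx; exists q => //; right.
  - by apply: contrapT => nA; case: Mx; exists q => //; right.
suff /fP/E0P[N /(_ N (leqnn N))] : f x = f (neg x).
  by rewrite /neg /xor_by; case: (x N).
apply/eqP; rewrite eq_le; apply/andP; split; rewrite leNgt; apply/negP => lt_f.
  have [q] := rat_in_itvoo lt_f; rewrite in_itv /= => /andP[fq qf].
  have Aq : A q x by apply/Aiff.
  by move: Aq; rewrite /A /= ltNge ltW.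
have [q] := rat_in_itvoo lt_f; rewrite in_itv /= => /andP[fq qf].
have Aq : A q (neg x) by apply/Aiff.
by move: Aq; rewrite /A /= ltNge ltW.
Qed.

(** * Sparse expansions *)

(* [num a n / den n] is the sum of [a i / den i.+1] over [i < n]. *)
Definition den (n : nat) : nat := (2 ^ 3 ^ n)%N.

Fixpoint num (a : nat -> nat) (n : nat) : nat :=
  if n is m.+1 then (den m ^ 2 * num a m + a m)%N else 0%N.

Definition sparse (a : nat -> nat) : Prop := forall n, (1 <= a n <= 2)%N.

Lemma denS n : den n.+1 = (den n ^ 3)%N.
Proof. by rewrite /den expnSr expnM. Qed.

Lemma ltn_den n : (n < den n)%N.
Proof. exact: ltn_trans (@ltn_expl 3 n isT) (@ltn_expl 2 (3 ^ n) isT). Qed.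

Lemma den_ge2 n : (2 <= den n)%N.
Proof. by rewrite /den -[leqLHS]expn1 leq_exp2l // expn_gt0. Qed.

Lemma eq_num a b n : (forall i, (i < n)%N -> a i = b i) -> num a n = num b n.
Proof.
by elim: n => //= n IHn ab; rewrite IHn ?ab // => i ?; rewrite ab // ltnW.
Qed.

Section Approximation.
Variable R : realType.
Implicit Types a b : nat -> nat.

Definition approx a n : R := (num a n)%:R / (den n)%:R.

Definition slope a : R := sup (range (approx a)).

Lemma den_gt0 n : 0 < (den n)%:R :> R.
Proof. by rewrite ltr0n (leq_trans _ (den_ge2 n)). Qed.

Lemma approx0 a : approx a 0 = 0.
Proof. by rewrite /approx mul0r. Qed.

Lemma approxS a n : approx a n.+1 = approx a n + (a n)%:R / (den n.+1)%:R.
Proof.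
have := den_gt0 n; rewrite /approx /= denS natrD !natrM !natrX => ?.
by field; rewrite gt_eqF.
Qed.

(** Makes the upper bounds [approx a n + 4 / den n.+1] nonincreasing in [n]: a new digit adds at
    most [2 / den n.+1]. *)
Lemma tail_step n :
  2 / (den n.+1)%:R + 4 / (den n.+2)%:R <= 4 / (den n.+1)%:R :> R.
Proof.
have h2 : 2 <= (den n.+1)%:R :> R by rewrite (ler_nat R 2) den_ge2.
have h0 := den_gt0 n.+1.
have -> : (den n.+2)%:R = (den n.+1)%:R ^+ 3 :> R by rewrite denS natrX.
set E : R := (den n.+1)%:R in h2 h0 *.
rewrite -subr_ge0.
have -> : 4 / E - (2 / E + 4 / E ^+ 3) = 2 * (E ^+ 2 - 2) / E ^+ 3.
  by field; rewrite gt_eqF.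
by apply: divr_ge0; [nra|apply: exprn_ge0; exact: ltW].
Qed.

Lemma approx_le a n m : approx a n <= approx a (n + m).
Proof.
elim: m => [|m IHm]; first by rewrite addn0.
rewrite addnS approxS (le_trans IHm) // lerDl divr_ge0 //.
Qed.

Lemma approx_tail a n m : sparse a ->
  approx a (n + m) + 4 / (den (n + m).+1)%:R <= approx a n + 4 / (den n.+1)%:R.
Proof.
move=> sa; elim: m => [|m IHm]; first by rewrite addn0.
apply: le_trans IHm; rewrite addnS approxS -addrA lerD2l.
apply: le_trans (tail_step _); rewrite lerD2r ler_pM2r ?invr_gt0 ?den_gt0 //.
by rewrite (ler_nat R _ 2); have /andP[] := sa (n + m)%N.
Qed.

Lemma approx_ubound a n : sparse a ->
  ubound (range (approx a)) (approx a n + 4 / (den n.+1)%:R).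
Proof.
move=> sa _ [m _ <-]; have [le_nm|/ltnW le_mn] := leqP n m.
  rewrite -(subnKC le_nm); apply: le_trans (approx_tail n (m - n) sa).
  by rewrite lerDl divr_ge0 // ltW // den_gt0.
rewrite -(subnKC le_mn); apply: le_trans (approx_le a m (n - m)) _.
by rewrite lerDl divr_ge0 // ltW // den_gt0.
Qed.

Lemma slope_bounds a n : sparse a ->
  approx a n <= slope a <= approx a n + 4 / (den n.+1)%:R.
Proof.
move=> sa; have ne : range (approx a) !=set0 by exists (approx a 0), 0%N.
apply/andP; split; last exact: ge_sup ne (approx_ubound _ sa).
apply: ub_le_sup; last by exists n.
by exists (approx a n + 4 / (den n.+1)%:R); exact: approx_ubound.
Qed.

Lemma slope_dist a n : sparse a ->
  `|slope a - approx a n| <= 4 / (den n.+1)%:R.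
Proof.
by move=> /(slope_bounds n)/andP[? ?]; rewrite ger0_norm; lra.
Qed.

End Approximation.

(** * Bilinear relations between sparse expansions *)

(** Used with [M = 1] for an integer of absolute value below 1, and with [M = den n ^ 2] to conclude
    from a congruence. *)
Lemma small_multiple_eq0 (M : nat) (x : int) : (`|x| < M)%N -> forall y : int,
  x = M%:Z * y -> x = 0.
Proof.
move=> xM y xy; apply/eqP; rewrite -absz_eq0; apply: contraTT xM => x0.
rewrite -leqNgt xy abszM absz_nat leq_pmulr // absz_gt0.
by apply: contra_neq x0 => y0; rewrite xy y0 mulr0.
Qed.

Section Relation.
Variable R : realType.

(** Here [A], [B] stand for partial sums, [dA], [dB] for their tails and [t] for [1 / den n]. As
    [dB <= 1], the three terms multiplied by [c] are each at most [4 * t ^+ 3]. *)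
Lemma bilinear_gap (c d e A B dA dB t : R) :
  0 <= A <= 1 -> 0 <= B <= 1 -> 0 < t -> t <= 1/2 ->
  0 <= dA <= 4 * t ^+ 3 -> 0 <= dB <= 4 * t ^+ 3 ->
  `|c * (A * dB + B * dA + dA * dB) + d * dB + e * dA|
    <= 4 * (3 * `|c| + `|d| + `|e|) * t ^+ 3.
Proof.
move=> /andP[A0 A1] /andP[B0 B1] t0 t1 /andP[a0 a1] /andP[b0 b1].
have t3 : 4 * t ^+ 3 <= 1 by rewrite !exprS expr0; nra.
set s := t ^+ 3 in a1 b1 t3 *.
apply: le_trans (ler_normD _ _) _.
apply: le_trans (lerD (ler_normD _ _) (lexx _)) _.
rewrite !normrM.
have hA : `|A * dB + B * dA + dA * dB| <= 12 * s by rewrite ger0_norm; nra.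
rewrite (ger0_norm a0) (ger0_norm b0).
have := ler_wpM2l (normr_ge0 c) hA.
have := ler_wpM2l (normr_ge0 d) b1.
have := ler_wpM2l (normr_ge0 e) a1.
lra.
Qed.

Variables (a b : nat -> nat).
Hypotheses (sa : sparse a) (sb : sparse b).

Section IntegerCoefficients.
Variables (c d e f : int).

(** The relation evaluated at the [n]-th partial sums, times [den n ^ 2] to make it an integer. *)
Definition relnum n : int :=
  c * (num a n)%:Z * (num b n)%:Z + d * (num b n)%:Z * (den n)%:Z +
  e * (num a n)%:Z * (den n)%:Z + f * (den n)%:Z ^+ 2.

Definition relbound : nat := (4 * (3 * `|c| + `|d| + `|e|))%N.

Hypothesis rel : c%:~R * slope R a * slope R b + d%:~R * slope R b +
  e%:~R * slope R a + f%:~R = 0.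

Lemma approx_01 a' n : sparse a' -> 0 <= approx R a' n <= 1.
Proof.
move=> sa'; rewrite divr_ge0 // ?ltW ?den_gt0 //=.
have := approx_tail R 0 n sa'; rewrite add0n approx0 add0r /den expn1 => h.
have h1 : 0 <= 4 / (den n.+1)%:R :> R by rewrite divr_ge0 // ltW // den_gt0.
by move: h h1; rewrite /den; lra.
Qed.

Lemma relnum_eq0 n : (relbound <= n)%N -> relnum n = 0.
Proof.
move=> le_n; apply: (@small_multiple_eq0 1 _ _ (relnum n)); last first.
  by rewrite mul1r.
have E0 := den_gt0 R n; have E2 : 2 <= (den n)%:R :> R.
  by rewrite (ler_nat R 2) den_ge2.
have /andP[a1 a2] := slope_bounds R n sa.
have /andP[b1 b2] := slope_bounds R n sb.
set t : R := (den n)%:R^-1.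
have t0 : 0 < t by rewrite invr_gt0.
have Et : (den n)%:R * t = 1 by rewrite mulfV ?gt_eqF.
have t3 : 4 / (den n.+1)%:R = 4 * t ^+ 3 :> R by rewrite denS natrX exprVn.
have gap := @bilinear_gap c%:~R d%:~R e%:~R (approx R a n) (approx R b n)
  (slope R a - approx R a n) (slope R b - approx R b n) t
  (approx_01 n sa) (approx_01 n sb) t0.
have {}gap : `|(relnum n)%:~R * t ^+ 2| <= relbound%:R * t ^+ 3 :> R.
  rewrite -normrN; have -> : relbound%:R =
      4 * (3 * `|c%:~R| + `|d%:~R| + `|e%:~R|) :> R.
    by rewrite /relbound natrM 2!natrD natrM !natr_absz !intr_norm.
  have -> : - ((relnum n)%:~R * t ^+ 2) =
    c%:~R * (approx R a n * (slope R b - approx R b n) +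
             approx R b n * (slope R a - approx R a n) +
             (slope R a - approx R a n) * (slope R b - approx R b n)) +
    d%:~R * (slope R b - approx R b n) + e%:~R * (slope R a - approx R a n).
    (* The exact relation replaces 0, so that only the errors of the partial sums remain. *)
    rewrite -[LHS]addr0 -rel /relnum /approx -/t !rmorphD !rmorphM /=.
    rewrite -!pmulrn /t; field.
    by rewrite gt_eqF.
  by apply: gap; nra.
rewrite -ltz_nat -(ltr_int R) abszE intr_norm.
have t2 : 0 < t ^+ 2 by rewrite exprn_gt0.
rewrite -(ltr_pM2r t2) mul1r; apply: le_lt_trans (_ : relbound%:R * t ^+ 3 < _).
  by rewrite -{1}(ger0_norm (ltW t2)) -normrM.
(* It remains that [relbound * t < 1], which holds since [relbound <= n < den n]. *)
rewrite exprS mulrA -[ltRHS]mul1r ltr_pM2r // -ltr_pdivlMr // div1r invrK.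
by rewrite ltr_nat; exact: leq_ltn_trans le_n (ltn_den n).
Qed.

(** The old terms, including all of [f], scale by [den n ^ 4]; the rest comes from the new
    digits. *)
Lemma relnumS n : relnum n.+1 = (den n)%:Z ^+ 4 * relnum n +
  c * ((den n)%:Z ^+ 2 * ((num a n)%:Z * (b n)%:Z + (num b n)%:Z * (a n)%:Z) +
       (a n)%:Z * (b n)%:Z) +
  (den n)%:Z ^+ 3 * (d * (b n)%:Z + e * (a n)%:Z).
Proof.
have E3 : (den n ^ 3)%N = (den n * den n * den n)%N.
  by rewrite !expnS expn0 muln1 mulnA.
by rewrite /relnum denS /= E3 -mulnn !PoszD !PoszM; ring.
Qed.

(* [relnum n] is an integer of absolute value [O(1 / den n)], hence 0 for large
   [n]. Reducing [relnum n.+1 = 0] modulo [den n ^ 2] then isolates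
   [c * a n * b n], which is bounded. *)
Lemma int_relation_trivial : c = 0 /\
  forall n, (relbound <= n)%N -> d * (b n)%:Z + e * (a n)%:Z = 0.
Proof.
have step n : (relbound <= n)%N ->
    c * ((den n)%:Z ^+ 2 * ((num a n)%:Z * (b n)%:Z + (num b n)%:Z * (a n)%:Z) +
       (a n)%:Z * (b n)%:Z) +
    (den n)%:Z ^+ 3 * (d * (b n)%:Z + e * (a n)%:Z) = 0.
  move=> le_n; have := relnumS n.
  by rewrite !relnum_eq0 ?mulr0 ?add0r // ltnW.
have c0 : c = 0.
  have := step _ (leqnn _); set n := relbound; move=> h.
  have /andP[a1 a2] := sa n; have /andP[b1 b2] := sb n.
  suff /eqP : c * ((a n)%:Z * (b n)%:Z) = 0.
    by rewrite !mulf_eq0 => /orP[/eqP//|]; lia.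
  apply: (@small_multiple_eq0 (den n ^ 2) _ _ (- (c * ((num a n)%:Z * (b n)%:Z +
     (num b n)%:Z * (a n)%:Z) + (den n)%:Z * (d * (b n)%:Z + e * (a n)%:Z)))).
    rewrite !abszM !absz_nat.
    (* Digits are at most 2, so the product is at most [4 * |c|]. *)
    have : (`|c| * (a n * b n) <= relbound)%N.
      apply: leq_trans (leq_mul (leqnn _) (leq_mul a2 b2)) _.
      by rewrite /relbound; lia.
    move=> /leq_ltn_trans; apply.
    by apply: (ltn_trans (ltn_den n)); have := den_ge2 n; nia.
  rewrite -mulnn PoszM; apply/eqP; rewrite -subr_eq0 -[X in _ == X]h; apply/eqP.
  ring.
split=> // n /step; rewrite c0 mul0r add0r => /eqP.
by rewrite mulf_eq0 expf_eq0 /= => /orP[|/eqP//]; have := den_ge2 n; lia.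
Qed.

End IntegerCoefficients.

Lemma relation_trivial (c d e f : rat) :
  ratr c * slope R a * slope R b + ratr d * slope R b +
    ratr e * slope R a + ratr f = 0 ->
  c = 0 /\ exists N, forall n, (N <= n)%N -> d * (b n)%:R + e * (a n)%:R = 0.
Proof.
(* [D] is a common denominator, reducing to integer coefficients. *)
move=> rel; pose D := denq c * denq d * denq e * denq f.
have D0 : D != 0 by rewrite !mulf_neq0 ?denq_neq0.
have DQ : D%:~R != 0 :> rat by rewrite intr_eq0.
have num_den (x : rat) : x * (denq x)%:~R = (numq x)%:~R by rewrite numqE.
have [k kE] : exists k : int, c * D%:~R = k%:~R.
  exists (numq c * denq d * denq e * denq f).
  by rewrite !rmorphM /= -num_den; ring.
have [l lE] : exists k : int, d * D%:~R = k%:~R.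
  exists (denq c * numq d * denq e * denq f).
  by rewrite !rmorphM /= -num_den; ring.
have [m mE] : exists k : int, e * D%:~R = k%:~R.
  exists (denq c * denq d * numq e * denq f).
  by rewrite !rmorphM /= -num_den; ring.
have [p pE] : exists k : int, f * D%:~R = k%:~R.
  exists (denq c * denq d * denq e * numq f).
  by rewrite !rmorphM /= -num_den; ring.
have scaleD (x : rat) (y : int) : x * D%:~R = y%:~R ->
    y%:~R = ratr x * D%:~R :> R.
  by move=> xy; rewrite -[D%:~R]ratr_int -rmorphM /= xy ratr_int.
have [k0 klm] : k = 0 /\ forall n, (relbound k l m <= n)%N ->
    l * (b n)%:Z + m * (a n)%:Z = 0.
  apply: (@int_relation_trivial k l m p).
  rewrite (scaleD _ _ kE) (scaleD _ _ lE) (scaleD _ _ mE) (scaleD _ _ pE).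
  by rewrite -[RHS](mul0r D%:~R) -rel; ring.
split; first by apply: (mulIf DQ); rewrite mul0r kE k0.
exists (relbound k l m) => n /klm /(congr1 (fun x : int => x%:~R : rat)).
rewrite rmorphD !rmorphM /= -lE -mE -!pmulrn => h.
by apply: (mulIf DQ); rewrite mul0r -[RHS]h; ring.
Qed.

End Relation.

(* The constant digits at even positions force the ratio of two eventually
   proportional digit sequences to be 1. *)
Definition digit (x : cantor_space) (n : nat) : nat :=
  (1 + (odd n && x n./2))%N.

Lemma digit_sparse x : sparse (digit x).
Proof. by move=> n; rewrite /digit; case: (odd n && x n./2). Qed.

Lemma digit_odd x n : digit x n.*2.+1 = (x n).+1.
Proof. by rewrite /digit /= odd_double /= uphalf_double. Qed.

Lemma digit_even x n : digit x n.*2 = 1%N.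
Proof. by rewrite /digit odd_double. Qed.

(** * Archimedean cones of irrational slope *)

Lemma mulmx2 (psi : 'M[rat]_2) (v : 'cV[rat]_2) i :
  (psi *m v) i 0 = psi i 0 * v 0 0 + psi i 1 * v 1 0.
Proof.
have l1 : lift ord0 ord0 = 1 :> 'I_2 by apply: val_inj.
by rewrite mxE big_ord_recl big_ord1 l1.
Qed.

Lemma col2_ext (v w : 'cV[rat]_2) : v 0 0 = w 0 0 -> v 1 0 = w 1 0 -> v = w.
Proof.
move=> vw0 vw1; apply/matrixP => i j; rewrite (ord1 j).
have [->|i0] := eqVneq i 0; first exact: vw0.
by rewrite (_ : i = 1) //; apply/val_inj; case: i i0 => [[|[|]]].
Qed.

(* The matrix with rows [1, -r] and [0, 1]. *)
Definition shear (r : rat) : 'M[rat]_2 :=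
  \matrix_(i, j) if i == j then 1 else if i == 0 then - r else 0.

Lemma shear_mul r (v : 'cV[rat]_2) : (shear r *m v) 0 0 = v 0 0 - r * v 1 0.
Proof. by rewrite mulmx2 !mxE /=; ring. Qed.

Lemma shear_mul1 r (v : 'cV[rat]_2) : (shear r *m v) 1 0 = v 1 0.
Proof. by rewrite mulmx2 !mxE /=; ring. Qed.

Lemma shearK r (v : 'cV[rat]_2) : shear r *m (shear (- r) *m v) = v.
Proof. by apply: col2_ext; rewrite !(shear_mul, shear_mul1); ring. Qed.

Lemma shear_unit r : shear r \in unitmx.
Proof.
suff /mulmx1_unit[] : shear r *m shear (- r) = 1%:M by [].
apply/matrixP => i j.
suff /matrixP/(_ i 0) :
    col j (shear r *m shear (- r)) = col j (1%:M : 'M[rat]_2).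
  by rewrite !mxE.
by rewrite !colE mul1mx -mulmxA shearK.
Qed.

Section LinearForm.
Variable R : realType.

Definition form (s : R) (v : 'cV[rat]_2) : R := ratr (v 0 0) + s * ratr (v 1 0).

Lemma formD s v w : form s (v + w) = form s v + form s w.
Proof. by rewrite /form !mxE !rmorphD /=; ring. Qed.

Lemma formZ s c v : form s (c *: v) = ratr c * form s v.
Proof. by rewrite /form !mxE !rmorphM /=; ring. Qed.

Lemma formN s v : form s (- v) = - form s v.
Proof. by rewrite -scaleN1r formZ rmorphN rmorph1 mulN1r. Qed.

Lemma form0 s : form s 0 = 0.
Proof. by rewrite /form !mxE rmorph0 mulr0 addr0. Qed.

Variable s : R.
(** This amounts to the irrationality of [s]. *)
Hypothesis form_inj : forall v, form s v = 0 -> v = 0.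

Lemma form_positive_cone : positive_cone [set v | 0 < form s v].
Proof.
split.
- by move=> v w /=; rewrite formD; exact: addr_gt0.
- apply/seteqP; split=> // v _.
  have [lt0|gt0|eq0] := ltgtP (form s v) 0.
  + left; right; exists (- v); last by rewrite opprK.
    by rewrite /= formN oppr_gt0.
  + by left; left.
  + by right; exact: form_inj.
- apply/seteqP; split=> // v /= [v0 [w w0 wv]].
  by move: v0; rewrite -wv formN oppr_gt0 ltNge ltW.
- by apply/seteqP; split=> // v /= [+ v0]; rewrite v0 form0 ltxx.
- apply/seteqP; split=> // v /= [[w w0 <-] /eqP].
  by rewrite oppr_eq0 => /eqP w0'; move: w0; rewrite w0' form0 ltxx.
Qed.

Lemma form_archimedean_cone : archimedean_cone [set v | 0 < form s v].
Proof.
move=> v w w0.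
have fw0 : form s w != 0 by apply: contra_neq w0; exact: form_inj.
(* Integers on both sides of the quotient, since the sign of [form s w] decides which one serves. *)
have [k kP] : exists k : int, form s v / form s w < k%:~R.
  by exists (Num.floor (form s v / form s w) + 1); exact: floorD1_gt.
have [k' kP'] : exists k : int, k%:~R < form s v / form s w.
  exists (Num.floor (form s v / form s w) - 1).
  by apply: lt_le_trans (ge_floor _); rewrite ltr_int gtrBl.
have formZi (i : int) : form s (w *~ i - v) = i%:~R * form s w - form s v.
  by rewrite formD formN -scaler_int formZ ratr_int.
have [lt0|gt0|/eqP] := ltgtP (form s w) 0; last by rewrite (negPf fw0).
  exists k'; rewrite /= formZi subr_gt0.
  by rewrite -ltr_ndivlMr.
by exists k; rewrite /= formZi subr_gt0 -ltr_pdivrMr.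
Qed.

End LinearForm.

(** * The reduction from [E0] to [ArQ2_iso] *)

Section Reduction.
Variable R : realType.

Definition slope_of (x : cantor_space) : R := slope R (digit x).

Lemma slope_of_form_inj x v : form (slope_of x) v = 0 -> v = 0.
Proof.
rewrite /form => fv0.
(* A rational slope would be a relation of the sequence with itself having [c = e = 0]. *)
have [|_ [N v10]] := @relation_trivial R _ _ (digit_sparse x) (digit_sparse x)
    0 (v 1 0) 0 (v 0 0).
  by rewrite rmorph0 -[RHS]fv0 /slope_of; ring.
have /eqP := v10 N (leqnn N).
rewrite mul0r addr0 mulf_eq0 pnatr_eq0 => /orP[]//.
move=> /eqP v1; move: fv0; rewrite v1 rmorph0 mulr0 addr0 => /eqP.
by rewrite fmorph_eq0 => /eqP v0; apply: col2_ext; rewrite mxE.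
Qed.

Definition cone_pred (x : cantor_space) : {ptws 'cV[rat]_2 -> bool} :=
  fun v => 0 < form (slope_of x) v.

Lemma cone_pred_ArQ2 x : ArQ2_set (cone_pred x).
Proof.
split; first exact: form_positive_cone (@slope_of_form_inj x).
exact: form_archimedean_cone (@slope_of_form_inj x).
Qed.

Definition slope_cone (x : cantor_space) : ArQ2 :=
  exist _ (cone_pred x) (mem_set (cone_pred_ArQ2 x)).

Lemma cone_of_slope_cone x :
  cone_of (slope_cone x) = [set v | 0 < form (slope_of x) v].
Proof. by []. Qed.

Lemma slope_of_near x y n : (forall i, (i < n)%N -> x i = y i) ->
  `|slope_of x - slope_of y| <= 8 / (den n.+1)%:R.
Proof.
move=> xy; have eqn : approx R (digit x) n = approx R (digit y) n.
  rewrite /approx (@eq_num _ (digit y)) // => i ni; rewrite /digit xy //.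
  by apply: leq_ltn_trans ni; rewrite leq_half_double; lia.
have := slope_dist R n (digit_sparse x).
have := slope_dist R n (digit_sparse y).
rewrite -eqn -/(slope_of x) -/(slope_of y) (distrC (slope_of y)) => hy hx.
apply: le_trans (ler_distD (approx R (digit x) n) _ _) _.
lra.
Qed.

Lemma den_eventually (e : R) : 0 < e ->
  exists N, forall n, (N <= n)%N -> 8 / (den n.+1)%:R < e.
Proof.
move=> e0; exists (Num.bound (8 / e)) => n le_n.
rewrite ltr_pdivrMr ?den_gt0 // mulrC -ltr_pdivrMr //.
apply: lt_trans (archi_boundP _) _; first by rewrite divr_ge0 // ltW.
rewrite ltr_nat; exact: leq_ltn_trans le_n (ltn_trans (ltnSn n) (ltn_den n.+1)).
Qed.

(** For [v != 0] the form is nonzero at [v], so it keeps its sign when the slope moves little. This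
    is continuity in each coordinate [v]. *)
Lemma cone_pred_locally_constant x v :
  exists n, forall y, cylinder n x y -> cone_pred y v = cone_pred x v.
Proof.
have [->|v0] := eqVneq v 0.
  by exists 0%N => y _; rewrite /cone_pred !form0.
have f0 : 0 < `|form (slope_of x) v|.
  by rewrite normr_gt0; apply: contra_neq v0; exact: slope_of_form_inj.
(* The summand 1 keeps [c] positive when [v 1 0 = 0]. *)
pose c : R := `|ratr (v 1 0)| + 1.
have c0 : 0 < c by rewrite ltr_wpDl.
have [n nP] := den_eventually (divr_gt0 f0 c0).
exists n => y yx; have := slope_of_near yx.
move=> /le_lt_trans/(_ (nP n (leqnn n))); rewrite ltr_pdivlMr // => near_xy.
have : `|form (slope_of y) v - form (slope_of x) v| < `|form (slope_of x) v|.
  apply: le_lt_trans near_xy.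
  rewrite (_ : _ - _ = (slope_of y - slope_of x) * ratr (v 1 0)).
    by rewrite normrM; apply: ler_wpM2l => //; rewrite /c lerDl.
  by rewrite /form; ring.
rewrite /cone_pred; move: (form _ _) f0 (form _ _) => fx _ fy.
by case: ltrgt0P => // ?; case: ltrgt0P => // ?;
  rewrite ltr_norml => /andP[? ?]; lra.
Qed.

Lemma slope_cone_continuous : continuous slope_cone.
Proof.
move=> x A [_ [[B oB <-] Bx sBA]].
suff : cone_pred @ x --> cone_pred x.
  move=> /(_ B (open_nbhs_nbhs (conj oB Bx))) xB.
  by apply: (@filterS _ (nbhs x) _ (cone_pred @^-1` B)) xB => y By; exact: sBA.
apply: cvg_prod_topology => v C /nbhs_singleton Cxv.
have [n nP] := cone_pred_locally_constant x v.
by apply: filterS (cylinder_nbhs n x) => y /nP /= ->.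
Qed.

Lemma E0_slope_diff x y :
  E0 x y -> exists r : rat, slope_of y - slope_of x = ratr r.
Proof.
(* Bit [n] only affects digit [n.*2.+1], so digits agree from [N.*2] on and the difference of
   partial sums stays equal to [r]. *)
move=> /E0P[N xy]; pose M := N.*2.
pose r : rat :=
  (num (digit y) M)%:R / (den M)%:R - (num (digit x) M)%:R / (den M)%:R.
have rE m : approx R (digit y) (M + m) - approx R (digit x) (M + m) = ratr r.
  elim: m => [|m IHm]; first by rewrite addn0 rmorphB !fmorph_div !rmorph_nat.
  rewrite addnS !approxS -IHm {2 4}/digit xy; first by ring.
  by rewrite geq_half_double leq_addr.
(* Two tails of at most [4 / den] each cannot account for a nonzero discrepancy. *)
exists r; apply/eqP; rewrite -subr_eq0 -normr_le0 leNgt; apply/negP.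
move=> /den_eventually[m mP]; have := mP (M + m)%N (leq_addl _ _).
rewrite -(rE m).
have := slope_dist R (M + m) (digit_sparse x).
have := slope_dist R (M + m) (digit_sparse y).
rewrite -/(slope_of x) -/(slope_of y) !ler_norml => /andP[? ?] /andP[? ?].
rewrite ltNge ler_norml => /negP; apply; apply/andP; split; lra.
Qed.

Lemma E0_ArQ2_iso x y : E0 x y -> ArQ2_iso (slope_cone x) (slope_cone y).
Proof.
move=> /E0_slope_diff[r rE]; exists (shear r); first exact: shear_unit.
have fE v : form (slope_of y) (shear r *m v) = form (slope_of x) v.
  rewrite /form shear_mul shear_mul1 rmorphB rmorphM /= -rE; ring.
rewrite !cone_of_slope_cone; apply/seteqP; split=> [_ [v /= v0 <-]|w /= w0].
  by rewrite /= fE.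
by exists (shear (- r) *m w); rewrite ?shearK //= -fE shearK.
Qed.

Lemma ArQ2_iso_E0 x y : ArQ2_iso (slope_cone x) (slope_cone y) -> E0 x y.
Proof.
move=> [psi psiU]; rewrite !cone_of_slope_cone => psiE.
(* Both forms have the same rational cut, hence are proportional, which makes
   the slopes satisfy a rational bilinear relation. *)
have signE v : (0 < form (slope_of y) (psi *m v)) = (0 < form (slope_of x) v).
  apply/idP/idP => [yv|xv].
    have : [set v | 0 < form (slope_of y) v] (psi *m v) by [].
    rewrite -psiE => -[u xu /(congr1 (mulmx (invmx psi)))].
    by rewrite !mulKmx // => <-.
  have : [set psi *m v | v in [set v | 0 < form (slope_of x) v]] (psi *m v).
    by exists v.
  by rewrite psiE.
set al := slope_of x in signE *; set be := slope_of y in signE *.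
pose l := ratr (psi 0 0) + be * ratr (psi 1 0) : R.
pose m := ratr (psi 0 1) + be * ratr (psi 1 1) : R.
have formE v : form be (psi *m v) = l * ratr (v 0 0) + m * ratr (v 1 0).
  by rewrite /form !mulmx2 !rmorphD !rmorphM /= /l /m; ring.
(* Test on the first basis vector. *)
have l0 : 0 < l.
  have := signE (\col_i (i == 0)%:R); rewrite formE /form !mxE /=.
  by rewrite rmorph1 rmorph0 !mulr0 !addr0 mulr1 ltr01.
(* Test on the vector with entries [q] and [-1]. *)
have cut q : (m < l * ratr q) = (al < ratr q).
  have := signE (\col_i if i == 0 then q else -1); rewrite formE /form !mxE /=.
  by rewrite rmorphN rmorph1 !mulrN1 !subr_gt0.
have ml : m = al * l.
  suff <- : m / l = al by rewrite divfK ?gt_eqF.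
  apply/eqP; rewrite eq_le; apply/andP; split.
  - rewrite leNgt; apply/negP => /rat_in_itvoo[q]; rewrite in_itv /= => /andP[].
    by rewrite -cut ltr_pdivlMr // mulrC => /lt_trans h /h; rewrite ltxx.
  - rewrite leNgt; apply/negP => /rat_in_itvoo[q]; rewrite in_itv /= => /andP[].
    by rewrite ltr_pdivrMr // mulrC cut => /lt_trans h /h; rewrite ltxx.
(* Expanding [m = al * l] gives these four coefficients. *)
have [|c0 [N dN]] := @relation_trivial R _ _ (digit_sparse x) (digit_sparse y)
    (psi 1 0) (- psi 1 1) (psi 0 0) (- psi 0 1).
  by rewrite !rmorphN -/(slope_of x) -/(slope_of y) -/al -/be;
    move: ml; rewrite /m /l => /eqP; rewrite -subr_eq0 => /eqP ml;
    rewrite -[RHS]oppr0 -ml; ring.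
have p0 : psi 0 0 != 0.
  apply/eqP => p0; move: l0; rewrite /l p0 c0 rmorph0 mulr0 addr0 ltxx //.
(* Even positions carry the digit 1 on both sides; the odd ones then compare the bits. *)
have pE : psi 1 1 = psi 0 0.
  have := dN N.*2; rewrite !digit_even !mulr1 -addnn leq_addr => /(_ isT) /eqP.
  by rewrite addrC subr_eq0 => /eqP.
apply/E0P; exists N => n le_n.
have le2 : (N <= n.*2.+1)%N by rewrite -addnn; lia.
have := dN _ le2; rewrite pE !digit_odd mulNr addrC => /eqP.
rewrite subr_eq0 => /eqP/(mulfI p0)/eqP; rewrite eqr_nat eqSS.
by case: (x n); case: (y n).
Qed.

Lemma E0_reducible_ArQ2_iso : borel_reducible E0 ArQ2_iso.
Proof.
exists slope_cone; split.
  exact: borel_map_continuous slope_cone_continuous.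
by move=> x y; split; [exact: E0_ArQ2_iso|exact: ArQ2_iso_E0].
Qed.

End Reduction.

Theorem theorem1p1 (R : realType) :
  borel_reducible E0 ArQ2_iso /\ ~ concretely_classifiable R ArQ2_iso.
Proof.
have [f [bf fP]] := E0_reducible_ArQ2_iso R.
split; first by exists f.
move=> [g [bg gP]]; apply: (@E0_not_concretely_classifiable R).
exists (g \o f); split; first exact: borel_map_comp.
by move=> x y; rewrite fP gP.
Qed.
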